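(* Let $T>0$ and $H\in(0,1)\setminus\{1/2\}$. Define $c_0:=0$ if $H<1/2$ and $c_0:=HT^{2H-2}$ if $H>1/2$, and for $k\ge1$ $$c_k:=\begin{cases}\dfrac{2}{T}\displaystyle\int_0^T t^{2H}\cos\frac{k\pi t}{T}\,\mathrm{d}t, & H<1/2,\\[2mm] -\dfrac{4H(2H-1)T}{(k\pi)^2}\displaystyle\int_0^T t^{2H-2}\cos\frac{k\pi t}{T}\,\mathrm{d}t, & H>1/2.\end{cases}$$ Let $(Z_k)_{k\in\mathbb{Z}}$ be independent standard Gaussian random variables, and for $N\ge1$ and $t\in[0,T]$ let $$B_t^N=\sqrt{c_0}\,t\,Z_0+\sum_{k=1}^{N}\sqrt{-\frac{c_k}{2}}\left(Z_k\sin\frac{k\pi t}{T}+Z_{-k}\left(1-\cos\frac{k\pi t}{T}\right)\right),$$ and let $B_t$ denote the corresponding infinite series (i.e. the limit of $B_t^N$ as $N\to\infty$). Then $$\sup_{t\in[0,T]}\sqrt{\mathbf{E}\left(B_t-B_t^N\right)^2}=\mathcal{O}\left(N^{-H}\right).$$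
   Context: The coefficients satisfy $c_k\le0$ for $k\ge1$, so the square roots are real. The limit defining $B_t$ is in mean square. The notation $a_N=\mathcal{O}(b_N)$ means $a_N\le C b_N$ for a constant $C>0$ not depending on $N$ (it may depend on $H,T$). *)

(* Defs.v *)
From HB Require Import structures.
From mathcomp Require Export all_boot all_order all_algebra finmap.
From mathcomp Require Export all_classical all_reals all_analysis.

Set Implicit Arguments.
Unset Strict Implicit.
Unset Printing Implicit Defensive.

Export Order.TTheory GRing.Theory Num.Theory.
Export numFieldNormedType.Exports.

Local Open Scope classical_set_scope.
Local Open Scope ring_scope.

Definition standard_gaussian d (Om : measurableType d) (R : realType)
    (P : probability Om R) (X : {RV P >-> R}) : Prop :=
  forall A : set R, measurable A -> distribution P X A = normal_prob 0 1 A.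

(* Mutual independence: the product rule over every finite subfamily. *)
Definition independent_RVs d (Om : measurableType d) (R : realType)
    (P : probability Om R) (I : choiceType) (X : I -> {RV P >-> R}) : Prop :=
  forall (J : {fset I}) (A : I -> set R),
    (forall i, i \in J -> measurable (A i)) ->
    P (\bigcap_(i in [set` J]) (X i @^-1` A i)) =
    (\prod_(i <- J) P (X i @^-1` A i))%E.

(* The second branch of each conditional is meant for H > 1/2.  There the
   integrand t^(2H-2) blows up at 0, whereas 0 `^ (2 * H - 2) = 0 by the
   convention of powR; this concerns a single point and does not affect the
   Lebesgue integral. *)
Definition c_ (R : realType) (H T : R) (k : nat) : R :=
  if k == 0%N then
    if H < 1 / 2 then 0 else H * T `^ (2 * H - 2)
  else if H < 1 / 2 then
    2 / T * \int[lebesgue_measure]_(t in `[0, T])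
              (t `^ (2 * H) * cos (k%:R * pi * t / T))
  else
    - (4 * H * (2 * H - 1) * T / (k%:R * pi) ^+ 2) *
      \int[lebesgue_measure]_(t in `[0, T])
        (t `^ (2 * H - 2) * cos (k%:R * pi * t / T)).

Definition partial_sum (Om : Type) (R : realType) (H T : R)
    (Z : int -> Om -> R) (N : nat) (t : R) (w : Om) : R :=
  Num.sqrt (c_ H T 0) * t * Z 0 w +
  \sum_(1 <= k < N.+1)
    Num.sqrt (- c_ H T k / 2) *
    (Z k%:Z w * sin (k%:R * pi * t / T) +
     Z (- k%:Z) w * (1 - cos (k%:R * pi * t / T))).

(* E (X - Y)^2 as an extended real, possibly +oo. *)
Definition mean_square_dist d (Om : measurableType d) (R : realType)
    (P : probability Om R) (X Y : Om -> R) : \bar R :=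
  'E_P[fun w => (X w - Y w) ^+ 2].

Definition mean_square_cvg d (Om : measurableType d) (R : realType)
    (P : probability Om R) (X : nat -> Om -> R) (Y : Om -> R) : Prop :=
  mean_square_dist P Y (X N) @[N --> \oo] --> 0%E.

(* Main.v *)
Require Import Defs.
From mathcomp Require Import measurable_realfun ring lra.

Set Implicit Arguments.
Unset Strict Implicit.
Unset Printing Implicit Defensive.

Local Open Scope classical_set_scope.
Local Open Scope ring_scope.

(** The increment [S_M - S_N] of the partial sums is a linear combination of the
    variables [Z_k] and [Z_(- k)] with [N < |k| <= M]. These are orthogonal in mean
    square and have the same second moment, so [E (S_M - S_N)^2] is at most a
    constant times the sum of [|c_k|] over [N < k <= M], uniformly in [t]
    ([partial_sum_remainder]). If [|c_k| = O(k^(- 2 H - 1))], that sum is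
    [O(N^(- 2 H))] by comparison with a telescoping one ([sum_powR_tail]), and
    taking square roots gives the rate [N^(- H)].

    The decay of [c_k] ([c_le]) comes from a single oscillatory integral, that of
    [t^s cos (k pi t / T)] over [[0, T]] with [-1 < s < 1]: here [s = 2 H] or
    [s = 2 H - 2]. It is cut at [e = T / k]. Below [e] the cosine is bounded by
    [1]; above [e] two integrations by parts are made, whose leading boundary term
    at [T] vanishes because [sin (k pi) = 0]. Each piece is of order
    [e^(s + 1)] ([norm_Rintegral_powR_cos_le]).

    The bound on [E (S_M - S_N)^2] makes the partial sums Cauchy in mean square,
    and [mean_square_complete] provides a limit. For an arbitrary mean-square limit
    [B], the inequality [(x + y)^2 <= 2 x^2 + 2 y^2] applied to
    [B - S_N = (B - S_M) + (S_M - S_N)] transfers the bound as [M] tends to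
    infinity ([mean_square_cvg_remainder]); the factor [2] goes into the
    constant. *)

(** * Integrals of powers against a cosine *)

Section oscillating_power.
Context {R : realType}.
Local Notation mu := (@lebesgue_measure R).
Implicit Types (a b e s t w T : R).

Lemma integral_derivative (F f : R -> R) a b : a < b ->
  (forall t, a <= t <= b -> derivable F t 1 /\ 'D_1 F t = f t) ->
  (forall t, a <= t <= b -> {for t, continuous f}) ->
  (\int[mu]_(t in `[a, b]) (f t)%:E = (F b - F a)%:E)%E.
Proof.
move=> ab dF cf.
have cF t : a <= t <= b -> {for t, continuous F}.
  move=> tab; apply: differentiable_continuous; apply/derivable1_diffP.
  by have [] := dF t tab.
rewrite EFinB; apply: continuous_FTC2 => //.
- apply: continuous_in_subspaceT => t /set_mem; rewrite /= in_itv/=; exact: cf.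
- split.
  + move=> t; rewrite in_itv/= => /andP[at_ tb].
    by have [] := dF t; rewrite ?(ltW at_) ?(ltW tb).
  + by apply: cvg_at_right_filter; apply: cF; rewrite lexx ltW.
  + by apply: cvg_at_left_filter; apply: cF; rewrite lexx ltW.
- move=> t; rewrite in_itv/= => /andP[at_ tb].
  by rewrite derive1E; have [|_ ->] := dF t; rewrite ?(ltW at_) ?(ltW tb).
Qed.

Lemma continuous_powR_gt0 s t : 0 < t -> {for t, continuous (fun x : R => x `^ s)}.
Proof.
move=> t0; apply: differentiable_continuous; apply/derivable1_diffP.
by apply: derivable_powR; rewrite in_itv/= t0.
Qed.

Lemma integral_powR s a b : s + 1 != 0 -> 0 < a < b ->
  (\int[mu]_(t in `[a, b]) (t `^ s)%:E =
   ((b `^ (s + 1) - a `^ (s + 1)) / (s + 1))%:E)%E.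
Proof.
move=> s1 /andP[a0 ab].
have pos t : a <= t <= b -> 0 < t by move=> /andP[/(lt_le_trans a0)].
rewrite (@integral_derivative (fun t => (s + 1)^-1 * t `^ (s + 1)))//.
- by congr EFin; ring.
- move=> t /pos t0; have := is_derive1_powR (s + 1) t0.
  rewrite addrK => h.
  suff [] : is_derive t 1 (fun t => (s + 1)^-1 * t `^ (s + 1)) (t `^ s) by [].
  apply: is_derive_eq.
  by rewrite /GRing.scale/= mulKf.
- by move=> t /pos; exact: continuous_powR_gt0.
Qed.

(** For [s < 0] the integrand blows up at [0], so the bound is obtained on
    [[e / (n + 2), e]], where the primitive is smooth, and passes to the limit by
    monotone convergence. *)
Lemma integral_powR_le s e : -1 < s -> 0 < e ->
  (\int[mu]_(t in `[0%R, e]) (t `^ s)%:E <= (e `^ (s + 1) / (s + 1))%:E)%E.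
Proof.
move=> s1 e0.
have s10 : 0 < s + 1 by lra.
have mp D : measurable_fun D (fun t => (t `^ s)%:E).
  by apply/measurable_EFinP/measurable_funTS; exact: measurable_powR.
rewrite -integral_itv_obnd_cbnd; last exact: mp.
pose F n := `[e / n.+2%:R, e]%classic.
have eS n : 0 < e / n.+2%:R by rewrite divr_gt0.
have -> : `]0%R, e]%classic = \bigcup_n F n.
  apply/seteqP; split => t /=; rewrite in_itv/=.
    move=> /andP[t0 te]; exists (Num.truncn (e / t)) => //=.
    rewrite /F/= in_itv/= te andbT ler_pdivrMr// mulrC -ler_pdivrMr//.
    rewrite (le_trans (ltW (truncnS_gt _)))// ler_nat; exact: leqnSn.
  move=> [n _]; rewrite /F/= in_itv/= => /andP[nt ->].
  by rewrite (lt_le_trans _ nt).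
have ndF : nondecreasing_seq F.
  move=> m n mn; apply/subsetPset => t; rewrite /F/= !in_itv/= => /andP[mt ->].
  rewrite andbT (le_trans _ mt)// ler_pM2l// lef_pV2 ?posrE//.
  by rewrite ler_nat !ltnS.
have cvgF := @ge0_nondecreasing_set_cvg_integral _ (measurableTypeR R) R F
  (fun t => (t `^ s)%:E) mu ndF (fun n => measurable_itv _) (fun n => mp (F n))
  (fun n t _ => powR_ge0 t s).
rewrite -(cvg_lim _ cvgF)//.
apply: lime_le; first by apply/cvg_ex; eexists; exact: cvgF.
apply: nearW => n; rewrite /F integral_powR ?gt_eqF ?eS//=; last first.
  by rewrite ltr_pdivrMr// ltr_pMr// ltr1n.
by rewrite lee_fin ler_pM2r ?invr_gt0// gerBl powR_ge0.
Qed.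

Lemma integrable_powR s T : -1 < s -> 0 < T ->
  mu.-integrable `[0, T] (fun t => (t `^ s)%:E).
Proof.
move=> s1 T0; apply/integrableP; split.
  by apply/measurable_EFinP/measurable_funTS; exact: measurable_powR.
under eq_integral do rewrite gee0_abs ?lee_fin ?powR_ge0//.
by rewrite (le_lt_trans (integral_powR_le s1 T0))// ltry.
Qed.

Lemma measurable_powR_cos s w (D : set R) :
  measurable_fun D (fun t => t `^ s * cos (w * t)).
Proof.
apply: measurable_funTS; apply: measurable_funM; first exact: measurable_powR.
apply: (@measurableT_comp _ _ _ _ _ _ (@cos R)).
  by apply: continuous_measurable_fun; exact: continuous_cos.
exact: measurable_funM.
Qed.

Lemma norm_powR_cos_le s w t : `|t `^ s * cos (w * t)| <= t `^ s.
Proof.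
rewrite normrM ger0_norm ?powR_ge0// ler_piMr ?powR_ge0//.
by rewrite ler_norml cos_geN1 cos_le1.
Qed.

Lemma integrable_powR_cos s w T : -1 < s -> 0 < T ->
  mu.-integrable `[0, T] (fun t => (t `^ s * cos (w * t))%:E).
Proof.
move=> s1 T0; apply: le_integrable (integrable_powR s1 T0) => //.
  by apply/measurable_EFinP; exact: measurable_powR_cos.
by move=> t _ /=; rewrite lee_fin [leRHS]ger0_norm ?powR_ge0// norm_powR_cos_le.
Qed.

Lemma norm_Rintegral_le (D : set (measurableTypeR R)) (f : R -> R) (c : R) :
  measurable D -> mu.-integrable D (fun t => (f t)%:E) ->
  (\int[mu]_(t in D) `|f t|%:E <= c%:E)%E -> `|\int[mu]_(t in D) f t| <= c.
Proof.
move=> mD intf fc; apply: le_trans (le_normr_Rintegral mD intf) _.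
rewrite -lee_fin fineK//; apply: integrable_fin_num => //.
exact: integrable_norm.
Qed.

(** This is two integrations by parts of [t^s cos (w t)] in one step: they leave an
    integrand of order [t^(s - 2)], which away from [0] is absolutely integrable
    with a bound that involves only the left end point. *)
Lemma is_derive_oscillating_primitive s w t : w != 0 -> 0 < t ->
  is_derive t 1
    (fun t => t `^ s * sin (w * t) / w + s * t `^ (s - 1) * cos (w * t) / w ^+ 2)
    (t `^ s * cos (w * t)
     + s * (s - 1) / w ^+ 2 * (t `^ (s - 2) * cos (w * t))).
Proof.
move=> w0 t0.
have hp := is_derive1_powR s t0.
have hp1 := is_derive1_powR (s - 1) t0.
have hs : is_derive t 1 (fun t => sin (w * t)) (cos (w * t) * w).
  apply: is_derive1_comp.
  by apply: is_derive_eq; rewrite /GRing.scale/= mulr1.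
have hc : is_derive t 1 (fun t => cos (w * t)) (- sin (w * t) * w).
  apply: is_derive1_comp.
  by apply: is_derive_eq; rewrite /GRing.scale/= mulr1.
apply: is_derive_eq; rewrite /GRing.scale/=.
have -> : s - 2 = s - 1 - 1 by ring.
by field.
Qed.

(** The boundary term [T^s sin (w T) / w] would not be small; it vanishes at the
    frequencies [w = k pi / T], and then every remaining term is controlled
    by a power of the left end point [e]. *)
Lemma norm_Rintegral_powR_cos_tail s w e T : -1 < s < 1 -> 0 < w ->
  0 < e < T -> sin (w * T) = 0 ->
  `|\int[mu]_(t in `[e, T]) (t `^ s * cos (w * t))| <=
    e `^ s / w + 3 * `|s| * e `^ (s - 1) / w ^+ 2.
Proof.
move=> /andP[s1 s2] w0 /andP[e0 eT] sinT.
have T0 : 0 < T by exact: lt_trans eT.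
have w_neq0 : w != 0 by rewrite gt_eqF.
have s10 : s - 1 != 0 by rewrite lt_eqF// subr_lt0.
pose k := s * (s - 1) / w ^+ 2.
pose g t := k * (t `^ (s - 2) * cos (w * t)).
pose h t := t `^ s * cos (w * t) + g t.
pose G t := t `^ s * sin (w * t) / w + s * t `^ (s - 1) * cos (w * t) / w ^+ 2.
have pos t : e <= t <= T -> 0 < t by move=> /andP[/(lt_le_trans e0)].
have ccos t : {for t, continuous (fun t => cos (w * t))}.
  apply: continuous_comp; last exact: continuous_cos.
  by apply: cvgM; [exact: cvg_cst|exact: cvg_id].
have cpc r t : 0 < t -> {for t, continuous (fun t => t `^ r * cos (w * t))}.
  by move=> t0; apply: cvgM; [exact: continuous_powR_gt0|exact: ccos].
have cg t : 0 < t -> {for t, continuous g}.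
  by move=> t0; apply: cvgM; [exact: cvg_cst|exact: cpc].
have ch t : 0 < t -> {for t, continuous h}.
  by move=> t0; apply: cvgD; [exact: cpc|exact: cg].
have int_cont (f : R -> R) : (forall t, 0 < t -> {for t, continuous f}) ->
    mu.-integrable `[e, T] (fun t => (f t)%:E).
  move=> cf; apply: continuous_compact_integrable; first exact: segment_compact.
  apply: continuous_in_subspaceT => t /set_mem; rewrite /= in_itv/= => /pos.
  exact: cf.
have ih := int_cont _ ch.
have ig := int_cont _ cg.
have ip := int_cont _ (@continuous_powR_gt0 (s - 2)).
have -> : \int[mu]_(t in `[e, T]) (t `^ s * cos (w * t)) =
    G T - G e - \int[mu]_(t in `[e, T]) g t.
  have <- : \int[mu]_(t in `[e, T]) h t = G T - G e.
    rewrite /Rintegral (@integral_derivative G h e T eT)// => t /pos t0; last exact: ch.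
    by have [] := is_derive_oscillating_primitive s w_neq0 t0.
  rewrite -RintegralB//; apply: eq_Rintegral => t _.
  by rewrite /h addrK.
have norm_trig (x y : R) : `|y| <= 1 -> `|x * y| <= `|x|.
  by move=> y1; rewrite normrM ler_piMr.
have cos1 t : `|cos (w * t)| <= 1 by rewrite ler_norml cos_geN1 cos_le1.
have sin1 t : `|sin (w * t)| <= 1 by rewrite ler_norml sin_geN1 sin_le1.
have w2 : 0 < w ^+ 2 by rewrite exprn_gt0.
have Tes : T `^ (s - 1) <= e `^ (s - 1).
  rewrite -opprB !powRN lef_pV2 ?posrE ?powR_gt0//.
  by apply: ge0_ler_powR; rewrite ?nnegrE ?subr_ge0 ltW.
have normc t : 0 < t -> `|s * t `^ (s - 1) * cos (w * t) / w ^+ 2| <=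
    `|s| * t `^ (s - 1) / w ^+ 2.
  move=> t0; rewrite normrM [ `|_^-1|]ger0_norm ?invr_ge0 ?(ltW w2)//.
  rewrite ler_pM2r ?invr_gt0// (le_trans (norm_trig _ _ (cos1 t)))//.
  by rewrite normrM [ `|_ `^ _|]ger0_norm ?powR_ge0.
have GT : `|G T| <= `|s| * e `^ (s - 1) / w ^+ 2.
  rewrite /G sinT mulr0 mul0r add0r (le_trans (normc _ T0))//.
  by rewrite ler_pM2r ?invr_gt0// ler_wpM2l.
have Ge : `|G e| <= e `^ s / w + `|s| * e `^ (s - 1) / w ^+ 2.
  rewrite /G (le_trans (ler_normD _ _))// lerD ?normc//.
  rewrite normrM [ `|_^-1|]ger0_norm ?invr_ge0 ?(ltW w0)//.
  rewrite ler_pM2r ?invr_gt0// (le_trans (norm_trig _ _ (sin1 e)))//.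
  by rewrite ger0_norm ?powR_ge0.
have Ig : `|\int[mu]_(t in `[e, T]) g t| <= `|s| * e `^ (s - 1) / w ^+ 2.
  apply: norm_Rintegral_le => //.
  apply: (@le_trans _ _ (\int[mu]_(t in `[e, T]) (`|k|%:E * (t `^ (s - 2))%:E))%E).
    apply: ge0_le_integral => //.
    - apply/measurable_EFinP; apply: measurableT_comp => //.
      by apply/measurable_EFinP; exact: (measurable_int mu ig).
    - by apply: emeasurable_funM => //; exact: (measurable_int mu ip).
    - move=> t _; rewrite -EFinM lee_fin /g normrM ler_wpM2l//.
      exact: norm_powR_cos_le.
  rewrite ge0_integralZl//; last 2 first.
  - exact: (measurable_int mu ip).
  - by move=> t _; rewrite lee_fin powR_ge0.
  have -> : s - 2 = s - 1 - 1 by ring.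
  rewrite integral_powR ?subrK ?e0// -EFinM lee_fin.
  have -> : `|k| = `|s| * (1 - s) / w ^+ 2.
    rewrite /k !normrM [ `|_^-1|]ger0_norm ?invr_ge0 ?(ltW w2)//.
    by rewrite [ `|s - 1|]ler0_norm ?opprB// subr_le0 ltW.
  have -> : `|s| * (1 - s) / w ^+ 2 * ((T `^ (s - 1) - e `^ (s - 1)) / (s - 1))
      = `|s| * (e `^ (s - 1) - T `^ (s - 1)) / w ^+ 2.
    by field; rewrite w_neq0.
  by rewrite ler_pM2r ?invr_gt0// ler_wpM2l// gerBl powR_ge0.
rewrite (le_trans (ler_normB _ _))//.
have := ler_normB (G T) (G e).
have -> : 3 * `|s| * e `^ (s - 1) / w ^+ 2 = 3 * (`|s| * e `^ (s - 1) / w ^+ 2).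
  by ring.
lra.
Qed.

(** On [[0, e]] the cosine is bounded by [1]; beyond [e] the oscillation is used.
    With [e] of the order of [1 / w] the three terms have the same size
    [e^(s + 1)]. *)
Lemma norm_Rintegral_powR_cos_le s w e T : -1 < s < 1 -> 0 < w ->
  0 < e <= T -> sin (w * T) = 0 ->
  `|\int[mu]_(t in `[0, T]) (t `^ s * cos (w * t))| <=
    e `^ (s + 1) / (s + 1) + e `^ s / w + 3 * `|s| * e `^ (s - 1) / w ^+ 2.
Proof.
move=> sb w0 /andP[e0]; have /andP[s1 _] := sb.
have w2 : 0 < w ^+ 2 by rewrite exprn_gt0.
have head : `|\int[mu]_(t in `[0, e]) (t `^ s * cos (w * t))| <=
    e `^ (s + 1) / (s + 1).
  apply: norm_Rintegral_le => //; first exact: integrable_powR_cos.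
  apply: le_trans (integral_powR_le s1 e0); apply: ge0_le_integral => //.
  - apply/measurable_EFinP; apply: measurableT_comp => //.
    exact: measurable_powR_cos.
  - by apply/measurable_EFinP/measurable_funTS; exact: measurable_powR.
  - by move=> t _; rewrite lee_fin norm_powR_cos_le.
rewrite le_eqVlt => /predU1P[<- _|eT sinT].
  rewrite -addrA (le_trans head)// lerDl addr_ge0//.
    by rewrite divr_ge0 ?powR_ge0// ltW.
  by rewrite divr_ge0 ?mulr_ge0 ?powR_ge0// ltW.
have T0 := lt_trans e0 eT.
have iT := integrable_powR_cos w s1 T0.
have eqT : \int[mu]_(t in `[0, T]) (t `^ s * cos (w * t)) =
    \int[mu]_(t in `[0, e]) (t `^ s * cos (w * t)) +
    \int[mu]_(t in `[e, T]) (t `^ s * cos (w * t)).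
  apply/eqP; rewrite addrC -subr_eq; apply/eqP.
  rewrite Rintegral_itvB ?bnd_simp ?ltW//.
  apply: Rintegral_itv_obnd_cbnd; apply: integrableS iT => //.
  by apply: subset_itvr; rewrite bnd_simp ltW.
rewrite eqT (le_trans (ler_normD _ _))// -addrA lerD//.
by apply: norm_Rintegral_powR_cos_tail => //; rewrite e0.
Qed.

End oscillating_power.

(** * Decay of the coefficients *)

Section coefficients.
Context {R : realType}.
Local Notation mu := (@lebesgue_measure R).
Implicit Types (a s t H T : R).

Lemma sin_natpi (k : nat) : sin (k%:R * pi : R) = 0.
Proof.
elim: k => [|k ih]; first by rewrite mul0r sin0.
by rewrite -natr1 mulrDl mul1r sinDpi ih oppr0.
Qed.

(** The cut is made at [e = T / k], one half-period of the cosine. *)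
Lemma powR_cos_coefficient_le s T : -1 < s < 1 -> 0 < T ->
  exists2 K : R, 0 < K & forall k : nat, (0 < k)%N ->
    `|\int[mu]_(t in `[0, T]) (t `^ s * cos (k%:R * pi * t / T))|
      <= K * k%:R `^ (- (s + 1)).
Proof.
move=> sb T0; have /andP[s1 _] := sb.
have s10 : 0 < s + 1 by lra.
have pi0 : 0 < pi :> R by exact: pi_gt0.
have pi_neq0 : pi != 0 :> R by rewrite gt_eqF.
have T_neq0 : T != 0 by rewrite gt_eqF.
(* With [w = pi / e] the three terms of the cut integral are [e^(s + 1)] times these. *)
exists (((s + 1)^-1 + pi^-1 + 3 * `|s| / pi ^+ 2) * T `^ (s + 1)).
  apply: mulr_gt0; last exact: powR_gt0.
  apply: ltr_wpDr; first by rewrite divr_ge0 ?sqr_ge0// mulr_ge0.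
  by rewrite addr_gt0// invr_gt0.
move=> k k0.
have kR : 0 < k%:R :> R by rewrite ltr0n.
have k_neq0 : k%:R != 0 :> R by rewrite gt_eqF.
pose w : R := k%:R * pi / T.
pose e : R := T / k%:R.
have w0 : 0 < w by rewrite divr_gt0 ?mulr_gt0.
have e0 : 0 < e by rewrite divr_gt0.
have e_neq0 : e != 0 by rewrite gt_eqF.
have eT : 0 < e <= T by rewrite e0 ler_pdivrMr// ler_peMr ?ler1n// ltW.
have sw : sin (w * T) = 0 by rewrite divfK// sin_natpi.
have := norm_Rintegral_powR_cos_le sb w0 eT sw.
have -> : \int[mu]_(t in `[0, T]) (t `^ s * cos (w * t)) =
    \int[mu]_(t in `[0, T]) (t `^ s * cos (k%:R * pi * t / T)).
  by apply: eq_Rintegral => t _; rewrite /w mulrAC.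
move=> /le_trans; apply.
have ws : w = pi / e by rewrite /w /e; field; rewrite k_neq0.
have es1 : e `^ (s - 1) = e `^ (s + 1) / e ^+ 2.
  have -> : s - 1 = s + 1 - 2%:R by ring.
  by rewrite powRB ?e_neq0 ?implybT// powR_mulrn ?ltW.
have es : e `^ s = e `^ (s + 1) / e.
  have {1}-> : s = s + 1 - 1 by ring.
  by rewrite powRB ?e_neq0 ?implybT// powRr1 ?ltW.
have -> : T `^ (s + 1) = e `^ (s + 1) * k%:R `^ (s + 1).
  by rewrite -powRM ?ltW// /e divfK.
rewrite powRN es1 es ws le_eqVlt; apply/orP; left; apply/eqP.
have kp : k%:R `^ (s + 1) != 0 by rewrite powR_eq0 (negbTE k_neq0).
move: (pi : R) pi_neq0 => p p_neq0.
by field; rewrite kp p_neq0 e_neq0 gt_eqF.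
Qed.

(** The exponent is [s = 2 H] in the first regime and [s = 2 H - 2] in the second,
    where the prefactor [k^-2] supplies the missing two powers. *)
Lemma c_le H T : 0 < T -> 0 < H < 1 -> H != 1 / 2 ->
  exists2 K : R, 0 < K & forall k : nat, (0 < k)%N ->
    `|c_ H T k| <= K * k%:R `^ (- (2 * H + 1)).
Proof.
move=> T0 /andP[H0 H1] H2.
have pi0 : 0 < pi :> R by exact: pi_gt0.
have pi_neq0 : pi != 0 :> R by rewrite gt_eqF.
have [Hlt|Hge] := ltP H (1 / 2).
  have sb : -1 < 2 * H < 1 by apply/andP; split; lra.
  have [K K0 hK] := powR_cos_coefficient_le sb T0.
  exists (2 / T * K); first by rewrite mulr_gt0 ?divr_gt0.
  move=> k k0; rewrite /c_ gtn_eqF// Hlt normrM.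
  have T2 : 0 <= 2 / T by rewrite divr_ge0 ?ltW.
  by rewrite ger0_norm// -[leRHS]mulrA ler_wpM2l// hK.
have {}Hge : 1 / 2 < H by rewrite lt_neqAle eq_sym H2.
have sb : -1 < 2 * H - 2 < 1 by apply/andP; split; lra.
have [K K0 hK] := powR_cos_coefficient_le sb T0.
pose L := 4 * H * (2 * H - 1) * T / pi ^+ 2.
have L0 : 0 < L.
  rewrite divr_gt0 ?exprn_gt0// mulr_gt0//.
  by rewrite !mulr_gt0//; lra.
exists (L * K); first exact: mulr_gt0.
move=> k k0; rewrite /c_ gtn_eqF// ltNge (ltW Hge)/= normrM normrN.
have kR : 0 < k%:R :> R by rewrite ltr0n.
have k_neq0 : k%:R != 0 :> R by rewrite gt_eqF.
have -> : 4 * H * (2 * H - 1) * T / (k%:R * pi) ^+ 2 = L / k%:R ^+ 2.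
  rewrite /L; move: (pi : R) pi_neq0 => p p_neq0.
  by field; rewrite k_neq0.
have Lk0 : 0 <= L / k%:R ^+ 2 by apply: divr_ge0; [exact: ltW|exact: sqr_ge0].
rewrite [ `|L / _|](ger0_norm Lk0).
apply: (@le_trans _ _ (L / k%:R ^+ 2 * (K * k%:R `^ (- (2 * H - 2 + 1))))).
  by rewrite ler_wpM2l ?hK.
have -> : - (2 * H - 2 + 1) = - (2 * H + 1) + 2%:R :> R by ring.
rewrite powRD ?k_neq0 ?implybT// powR_mulrn ?(ltW kR)//.
rewrite le_eqVlt; apply/orP; left; apply/eqP.
by field.
Qed.

(** With [q = k / (k + 1)], the claim is [1 + a / (k + 1) <= q^(- a)], which follows
    from [exp x >= 1 + x] and [ln q <= q - 1 = - 1 / (k + 1)]. *)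
Lemma powR_telescope_ge a (k : nat) : 0 < a -> (0 < k)%N ->
  a * k.+1%:R `^ (- (a + 1)) <= k%:R `^ (- a) - k.+1%:R `^ (- a).
Proof.
move=> a0 k0.
have kR : 0 < k%:R :> R by rewrite ltr0n.
have k1R : 0 < k.+1%:R :> R by rewrite ltr0n.
have k1_neq0 : k.+1%:R != 0 :> R by rewrite gt_eqF.
pose q : R := k%:R / k.+1%:R.
have q0 : 0 < q by rewrite divr_gt0.
have -> : k%:R `^ (- a) = k.+1%:R `^ (- a) * q `^ (- a).
  by rewrite -powRM ?ltW// /q mulrC divfK.
have -> : k.+1%:R `^ (- (a + 1)) = k.+1%:R `^ (- a) / k.+1%:R.
  by rewrite opprD powRB ?k1_neq0 ?implybT// powRr1 ?ltW.
rewrite mulrCA -[X in _ <= _ - X]mulr1 -mulrBr ler_wpM2l ?powR_ge0//.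
rewrite lerBrDr /powR gt_eqF//.
apply: le_trans (expR_ge1Dx _); rewrite addrC lerD2l mulNr -mulrN.
rewrite ler_wpM2l ?(ltW a0)// lerNr.
have qE : q = 1 + - k.+1%:R^-1.
  by rewrite /q -natr1; field; rewrite -natr1 in k1_neq0.
rewrite qE; apply: le_ln1Dx.
by rewrite ltrN2 invf_lt1// ltr1n ltnS.
Qed.

Lemma sum_powR_tail a (N M : nat) : 0 < a -> (0 < N)%N -> (N <= M)%N ->
  \sum_(N.+1 <= k < M.+1) k%:R `^ (- (a + 1)) <= N%:R `^ (- a) / a.
Proof.
move=> a0 N0 NM.
(* The telescoped bound is what the induction on [M] carries. *)
suff : \sum_(N.+1 <= k < M.+1) k%:R `^ (- (a + 1)) <=
    (N%:R `^ (- a) - M%:R `^ (- a)) / a.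
  by move=> /le_trans; apply; rewrite ler_pM2r ?invr_gt0// gerBl powR_ge0.
elim: M NM => [|M ih]; first by rewrite leqn0 => /eqP N00; rewrite N00 in N0.
rewrite leq_eqVlt => /predU1P[->|NM].
  by rewrite big_geq// subrr mul0r.
rewrite big_nat_recr//=.
have M0 : (0 < M)%N by exact: leq_trans N0 _.
rewrite (le_trans (lerD (ih _) (lexx _)))//.
have := powR_telescope_ge a0 M0.
rewrite mulrC -ler_pdivlMr// => h.
rewrite (le_trans (lerD (lexx _) h))// -mulrDl ler_pM2r ?invr_gt0//.
by rewrite addrA subrK.
Qed.

End coefficients.

Lemma cvg_natS_powRN (R : realType) (a : R) : 0 < a ->
  (n.+1%:R : R) `^ (- a) @[n --> \oo] --> 0.
Proof.
move=> a0.
have -> : (fun n : nat => (n.+1%:R : R) `^ (- a)) =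
    (fun n : nat => (n.+1%:R^-1 : R) `^ a).
  by apply/funext => n; rewrite -powR_inv1// -powRrM mulN1r.
have /cvg_at_rightP := @powR_cvg0 R _ a0.
apply; split; first by move=> n; rewrite invr_gt0.
exact: cvg_harmonic.
Qed.

(** * Orthogonality in mean square *)

Section square_integrable.
Context d (Om : measurableType d) (R : realType) (mu : {measure set Om -> \bar R}).
Implicit Types X Y : Om -> R.

(** [|X Y| <= X^2 + Y^2]. *)
Lemma integrable_mul_square X Y :
  measurable_fun setT X -> measurable_fun setT Y ->
  (\int[mu]_w (X w ^+ 2)%:E < +oo)%E -> (\int[mu]_w (Y w ^+ 2)%:E < +oo)%E ->
  mu.-integrable setT (fun w => (X w * Y w)%:E).
Proof.
move=> mX mY X2 Y2.
have isq (Z : Om -> R) : measurable_fun setT Z -> (\int[mu]_w (Z w ^+ 2)%:E < +oo)%E ->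
    mu.-integrable setT (fun w => (Z w ^+ 2)%:E).
  move=> mZ Z2; apply/integrableP; split.
    by apply/measurable_EFinP; exact: measurable_funX.
  by under eq_integral do rewrite /= ger0_norm ?sqr_ge0//.
apply: le_integrable (integrableD _ (isq _ mX X2) (isq _ mY Y2)) => //.
  by apply/measurable_EFinP; exact: measurable_funM.
move=> w _ /=; rewrite lee_fin [leRHS]ger0_norm ?addr_ge0 ?sqr_ge0//.
by rewrite ler_norml; apply/andP; split; nra.
Qed.

Lemma integral_sqr_orthogonal_sum (I : eqType) (r : seq I) (X : I -> Om -> R)
    (m : R) (a : I -> R) :
  (forall i, measurable_fun setT (X i)) ->
  (forall i, \int[mu]_w (X i w ^+ 2)%:E = m%:E)%E ->
  (forall i j, i != j -> \int[mu]_w (X i w * X j w)%:E = 0)%E ->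
  uniq r ->
  (\int[mu]_w ((\sum_(i <- r) a i * X i w) ^+ 2)%:E =
   (m * \sum_(i <- r) a i ^+ 2)%:E)%E.
Proof.
move=> mX X2 X0 ur.
have iX i j : mu.-integrable setT (fun w => (X i w * X j w)%:E).
  by apply: integrable_mul_square; rewrite ?X2 ?ltry.
have iaX i j : mu.-integrable setT (fun w => (a i * a j)%:E * (X i w * X j w)%:E)%E.
  exact: integrableZl.
transitivity (\int[mu]_w \sum_(i <- r) \sum_(j <- r)
    ((a i * a j)%:E * (X i w * X j w)%:E))%E.
  apply: eq_integral => w _; rewrite expr2 big_distrlr/= -sumEFin.
  apply: eq_bigr => i _; rewrite -sumEFin; apply: eq_bigr => j _.
  by rewrite -EFinM mulrACA.
rewrite integral_sum//; last by move=> i; exact: integrable_sum.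
rewrite mulr_sumr -sumEFin big_seq [RHS]big_seq; apply: eq_bigr => i ir.
rewrite integral_sum// (bigD1_seq i)//= big1 ?adde0; last first.
  by move=> j ji; rewrite integralZl// X0 ?mule0// eq_sym.
by rewrite integralZl// X2 -EFinM mulrC expr2.
Qed.

End square_integrable.

(** * Gaussian variables *)

Section gaussian.
Variable R : realType.
Local Notation mu := (@lebesgue_measure R).
Local Notation gamma := (normal_prob (0 : R) 1).

Lemma normal_probN (A : set R) : measurable A ->
  gamma (-%R @^-1` A) = gamma A.
Proof.
move=> mA; rewrite /normal_prob.
have pdfN (x : R) : normal_pdf 0 1 x = normal_pdf 0 1 (- x).
  by rewrite !normal_pdfE ?oner_eq0// /normal_fun !subr0 sqrrN.
have mpdf : measurable_fun A (EFin \o (normal_pdf (0 : R) 1)).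
  by apply/measurable_EFinP/measurable_funTS; exact: measurable_normal_pdf.
have mN : measurable_fun [set: R] (-%R : R -> measurableTypeR R) by [].
rewrite [RHS](@eq_measure_integral _ _ _ _
    (pushforward mu (-%R : R -> measurableTypeR R))); last first.
  by move=> B mB _; exact: (esym (lebesgue_measureN mB)).
rewrite ge0_integral_pushforward//; last first.
  by move=> x _; rewrite lee_fin normal_pdf_ge0.
by apply: eq_integral => x _ /=; rewrite -pdfN.
Qed.

(** The Gaussian density is a Radon-Nikodym derivative by the very definition of
    [normal_prob], and such derivatives are unique almost everywhere. *)
Lemma ge0_integral_normal_prob (f : R -> \bar R) :
  (forall x, 0 <= f x)%E -> measurable_fun [set: R] f ->
  (\int[gamma]_x f x = \int[mu]_x (f x * (normal_pdf 0 1 x)%:E))%E.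
Proof.
move=> f0 mf.
have dom : gamma `<< mu by exact: normal_prob_dominates.
rewrite -(Radon_Nikodym_SigmaFinite.change_of_variables dom f0 measurableT mf).
have mRN : measurable_fun [set: R] (Radon_Nikodym_SigmaFinite.f gamma mu).
  exact: (measurable_int _ (Radon_Nikodym_SigmaFinite.f_integrable dom)).
have mpdf : measurable_fun [set: R] (EFin \o (normal_pdf (0 : R) 1)).
  by apply/measurable_EFinP; exact: measurable_normal_pdf.
apply: ae_eq_integral => //; [exact: emeasurable_funM..|].
apply: ae_eqe_mul2l; apply: integral_ae_eq => //.
- exact: (Radon_Nikodym_SigmaFinite.f_integrable dom).
- by move=> E _ mE; rewrite -Radon_Nikodym_SigmaFinite.f_integral.
Qed.

(** Since [x^2 / 4 <= exp (x^2 / 4)], the function [x^2 exp (- x^2 / 2)] is dominated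
    by [4 exp (- x^2 / 4)], a multiple of the Gaussian density of variance [2]. *)
Lemma normal_second_moment_lty : (\int[gamma]_x (x ^+ 2)%:E < +oo)%E.
Proof.
rewrite ge0_integral_normal_prob; last 2 first.
- by move=> x; rewrite lee_fin sqr_ge0.
- by apply/measurable_EFinP; exact: measurable_funX.
set s : R := Num.sqrt 2.
have s2 : s ^+ 2 = 2 by rewrite sqr_sqrtr.
have s0 : s != 0 by rewrite gt_eqF// sqrtr_gt0.
pose K : R := 4 * normal_peak 1 / normal_peak s.
have K0 : 0 <= K by rewrite divr_ge0 ?mulr_ge0 ?normal_peak_ge0.
have le_pdf (x : R) : x ^+ 2 * normal_pdf 0 1 x <= K * normal_pdf 0 s x.
  have pdfE (r : R) : r != 0 ->
      normal_pdf 0 r x = normal_peak r * expR (- x ^+ 2 / (r ^+ 2 *+ 2)).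
    by move=> r0; rewrite normal_pdfE// /normal_fun subr0.
  rewrite !pdfE ?oner_eq0// /K [leRHS]mulrA divfK ?gt_eqF ?normal_peak_gt0//.
  rewrite mulrCA (mulrC 4) -[leRHS]mulrA ler_wpM2l ?normal_peak_ge0//.
  rewrite s2 expr1n.
  set u := x ^+ 2 / 4.
  have -> : - x ^+ 2 / 2 = - u + - u :> R by rewrite /u; field.
  have -> : - x ^+ 2 / (2 *+ 2) = - u :> R by rewrite /u; field.
  rewrite expRD mulrA ler_wpM2r ?expR_ge0//.
  rewrite expRN ler_pdivrMr ?expR_gt0//.
  by have := expR_ge1Dx u; rewrite /u; lra.
apply: (@le_lt_trans _ _ (\int[mu]_x (K%:E * (normal_pdf 0 s x)%:E))%E).
  apply: ge0_le_integral => //.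
  - by move=> x _; rewrite mule_ge0// lee_fin ?sqr_ge0 ?normal_pdf_ge0.
  - apply: emeasurable_funM; apply/measurable_EFinP; first exact: measurable_funX.
    exact: measurable_normal_pdf.
  - apply: emeasurable_funM; apply/measurable_EFinP => //.
    exact: measurable_normal_pdf.
  - by move=> x _; rewrite -!EFinM lee_fin; exact: le_pdf.
rewrite ge0_integralZl//=.
- by rewrite integral_normal_pdf// mule1 ltry.
- by apply/measurable_EFinP; exact: measurable_normal_pdf.
- by move=> x _; rewrite lee_fin normal_pdf_ge0.
Qed.

End gaussian.

Section gaussian_pair.
Context d (Om : measurableType d) (R : realType) (P : probability Om R).
Local Notation gamma := (normal_prob (0 : R) 1).

(** The common value of all [E (Z_k)^2]; the estimates only see that it is a
    finite number attached to [R] alone. *)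
Definition gauss_sqr : R := fine (\int[gamma]_x (x ^+ 2)%:E)%E.

Lemma integral_sqr_gaussian (X : {RV P >-> R}) : standard_gaussian X ->
  (\int[P]_w (X w ^+ 2)%:E = gauss_sqr%:E)%E.
Proof.
move=> gX.
have m2 : measurable_fun setT (fun x : R => (x ^+ 2)%:E).
  by apply/measurable_EFinP; exact: measurable_funX.
rewrite /gauss_sqr fineK; last first.
  rewrite ge0_fin_numE ?normal_second_moment_lty//.
  by apply: integral_ge0 => x _; rewrite lee_fin sqr_ge0.
have mX : measurable_fun setT (X : Om -> measurableTypeR R).
  exact: (@measurable_funPT _ _ _ _ X).
pose X' : {mfun Om >-> measurableTypeR R} :=
  @mfun_Sub _ _ Om (measurableTypeR R) X (mem_set mX).
transitivity (\int[distribution P X']_x (x ^+ 2)%:E)%E.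
  rewrite (@ge0_integral_distribution _ _ _ _ _ P X' (fun x => (x ^+ 2)%:E))//.
  by move=> y; rewrite lee_fin sqr_ge0.
by apply: eq_measure_integral => A mA _; exact: (gX A mA).
Qed.

(** The standard Gaussian law is symmetric, so by independence [(X, Y)] and
    [(X, - Y)] have the same joint law, the product law; hence
    [E (X Y) = - E (X Y)]. *)
Lemma gaussian_uncorrelated (X Y : {RV P >-> R}) :
  standard_gaussian X -> standard_gaussian Y ->
  (forall A B, measurable A -> measurable B ->
     P (X @^-1` A `&` Y @^-1` B) = (P (X @^-1` A) * P (Y @^-1` B))%E) ->
  (\int[P]_w (X w * Y w)%:E = 0)%E.
Proof.
move=> gX gY XY.
have mX : measurable_fun setT (X : Om -> measurableTypeR R).
  exact: (@measurable_funPT _ _ _ _ X).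
have mY : measurable_fun setT (Y : Om -> measurableTypeR R).
  exact: (@measurable_funPT _ _ _ _ Y).
(* The joint law of [(X, s Y)], for [s = 1] and [s = -1]. *)
pose law (s : R) (w : Om) : measurableTypeR R * measurableTypeR R := (X w, s * Y w).
have mlaw s : measurable_fun setT (law s).
  by apply: measurable_fun_pair => //; exact: measurable_funM.
pose Law s : {mfun Om >-> (measurableTypeR R * measurableTypeR R)%type} :=
  @mfun_Sub _ _ Om (measurableTypeR R * measurableTypeR R)%type (law s)
    (mem_set (mlaw s)).
pose f (z : measurableTypeR R * measurableTypeR R) : \bar R := (z.1 * z.2)%:E.
have mf : measurable_fun setT f.
  by apply/measurable_EFinP; apply: measurable_funM.
have iXY s : P.-integrable setT (f \o Law s).
  apply: (@integrable_mul_square _ _ _ P X (fun w => s * Y w)) => //.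
  - exact: measurable_funM.
  - by rewrite integral_sqr_gaussian// ltry.
  - under eq_integral do rewrite exprMn EFinM.
    rewrite ge0_integralZl//.
    + by rewrite integral_sqr_gaussian// -EFinM ltry.
    + by apply/measurable_EFinP; exact: measurable_funX.
    + by move=> w _; rewrite lee_fin sqr_ge0.
    + by rewrite lee_fin sqr_ge0.
have prodE s : s = 1 \/ s = -1 -> forall C, measurable C ->
    distribution P (Law s) C = (gamma \x gamma)%E C.
  move=> s1 C mC; apply/esym/product_measure_unique => // A B mA mB.
  rewrite /= /distribution /pushforward.
  have -> : law s @^-1` (A `*` B) = X @^-1` A `&` Y @^-1` ( *%R s @^-1` B).
    by [].
  have msB : measurable ( *%R s @^-1` B).
    rewrite -[X in measurable X]setTI.
    by apply: (measurable_funM (measurable_cst s) (@measurable_id _ _ _)).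
  rewrite XY//; congr (_ * _)%E; first exact: gX.
  rewrite [LHS](gY _ msB); case: s1 => ->.
    by congr (gamma _); apply/seteqP; split => x /=; rewrite mul1r.
  rewrite -[RHS](normal_probN mB).
  by congr (gamma _); apply/seteqP; split => x /=; rewrite mulN1r.
have E s : (\int[P]_w (s * (X w * Y w))%:E = \int[distribution P (Law s)]_z f z)%E.
  rewrite integral_distribution//.
  by apply: eq_integral => w _; rewrite /f/= mulrCA.
have : (\int[P]_w (X w * Y w)%:E = - \int[P]_w (X w * Y w)%:E)%E.
  transitivity (\int[P]_w (1 * (X w * Y w))%:E)%E.
    by apply: eq_integral => w _; rewrite mul1r.
  transitivity (\int[P]_w ((-1) * (X w * Y w))%:E)%E.
    rewrite !E; apply: eq_measure_integral => C mC _.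
    exact: etrans (prodE 1 (or_introl erefl) C mC)
      (esym (prodE (-1) (or_intror erefl) C mC)).
  have i1 : P.-integrable setT (fun w => (X w * Y w)%:E).
    by move: (iXY 1); apply: eq_integrable => // w _; rewrite /f/= mul1r.
  under eq_integral do rewrite EFinM.
  by rewrite integralZl// EFinN mulN1e.
have fin : (\int[P]_w (X w * Y w)%:E)%E \is a fin_num.
  apply: integrable_fin_num => //.
  by move: (iXY 1); apply: eq_integrable => // w _; rewrite /f/= mul1r.
rewrite -(fineK fin) -EFinN => -[h]; congr EFin; lra.
Qed.

End gaussian_pair.

Lemma independent_RVs_pair d (Om : measurableType d) (R : realType)
    (P : probability Om R) (I : choiceType) (Z : I -> {RV P >-> R}) (i j : I)
    (A B : set R) :
  independent_RVs Z -> i != j -> measurable A -> measurable B ->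
  P (Z i @^-1` A `&` Z j @^-1` B) = (P (Z i @^-1` A) * P (Z j @^-1` B))%E.
Proof.
move=> indep ij mA mB.
have ji : (j == i) = false by rewrite eq_sym (negbTE ij).
pose C k := if k == i then A else B.
have := indep [fset i; j]%fset C.
rewrite big_fsetU1/= ?inE// big_seq_fset1 /C eqxx ji => <-.
  congr (P _); apply/seteqP; split => w /=.
    move=> [Aw Bw] k /=; rewrite !inE => /orP[|] /eqP ->; first by rewrite eqxx.
    by rewrite ji.
  move=> h; split.
    by have := h i; rewrite /= !inE !eqxx; exact.
  by have := h j; rewrite /= !inE !eqxx orbT ji; exact.
by move=> k _; case: ifP.
Qed.

(** * Mean-square limits *)

Lemma integral_sqr_le d (Om : measurableType d) (R : realType)
    (mu : {measure set Om -> \bar R}) (X U V : Om -> R) :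
  measurable_fun setT X -> measurable_fun setT U -> measurable_fun setT V ->
  (forall w, X w = U w + V w) ->
  (\int[mu]_w (X w ^+ 2)%:E <=
   2%:E * \int[mu]_w (U w ^+ 2)%:E + 2%:E * \int[mu]_w (V w ^+ 2)%:E)%E.
Proof.
move=> mX mU mV XUV.
have msq (Y : Om -> R) : measurable_fun setT Y ->
    measurable_fun setT (fun w => (Y w ^+ 2)%:E).
  by move=> mY; apply/measurable_EFinP; exact: measurable_funX.
have sq0 (Y : Om -> R) w : setT w -> (0 <= (Y w ^+ 2)%:E)%E.
  by move=> _; rewrite lee_fin sqr_ge0.
have sq02 (Y : Om -> R) w : setT w -> (0 <= 2%:E * (Y w ^+ 2)%:E)%E.
  by move=> _; rewrite -EFinM lee_fin mulr_ge0// sqr_ge0.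
have msq2 (Y : Om -> R) : measurable_fun setT Y ->
    measurable_fun setT (fun w => 2%:E * (Y w ^+ 2)%:E)%E.
  by move=> mY; apply: emeasurable_funM => //; exact: msq.
rewrite -!ge0_integralZl//; [|exact: msq|exact: sq0|exact: msq|exact: sq0].
rewrite -ge0_integralD//; [|exact: sq02|exact: msq2|exact: sq02|exact: msq2].
apply: ge0_le_integral => //.
- exact: sq0.
- exact: msq.
- by apply: emeasurable_funD; exact: msq2.
- move=> w _; rewrite -!EFinM -EFinD lee_fin XUV.
  have := sqr_ge0 (U w - V w); nra.
Qed.

Section mean_square_completeness.
Context d (Om : measurableType d) (R : realType) (P : probability Om R).
Implicit Types X : nat -> Om -> R.

Lemma measurable_sqr_dist (U V : Om -> R) :
  measurable_fun setT U -> measurable_fun setT V ->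
  measurable_fun setT (fun w => ((U w - V w) ^+ 2)%:E).
Proof.
move=> mU mV; apply/measurable_EFinP/measurable_funX.
exact: measurable_funB.
Qed.

(** From [2 c |u| <= c^2 + u^2]. *)
Lemma integral_norm_le (U : Om -> R) (c : R) : 0 < c ->
  measurable_fun setT U -> (\int[P]_w (U w ^+ 2)%:E <= (c ^+ 2)%:E)%E ->
  (\int[P]_w `|U w|%:E <= c%:E)%E.
Proof.
move=> c0 mU U2.
have mU2 : measurable_fun setT (fun w => (U w ^+ 2)%:E).
  by apply/measurable_EFinP; exact: measurable_funX.
apply: (@le_trans _ _
    (\int[P]_w ((c / 2)%:E + (2 * c)^-1%:E * (U w ^+ 2)%:E))%E).
  apply: ge0_le_integral => //.
  - by apply/measurable_EFinP; exact: measurableT_comp.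
  - apply: emeasurable_funD => //.
    by apply: emeasurable_funM => //; exact/measurable_EFinP.
  - move=> w _; rewrite -EFinM -EFinD lee_fin -real_normK ?num_real//.
    rewrite -subr_ge0 [leRHS](_ : _ = (c - `|U w|) ^+ 2 / (2 * c)).
      by rewrite divr_ge0 ?sqr_ge0// mulr_ge0// ltW.
    by field; rewrite gt_eqF.
have c2 : 0 <= (2 * c)^-1 by rewrite invr_ge0 mulr_ge0// ltW.
rewrite ge0_integralD//; last 3 first.
- by move=> w _; rewrite lee_fin divr_ge0// ltW.
- by move=> w _; rewrite -EFinM lee_fin mulr_ge0// sqr_ge0.
- by apply: emeasurable_funM => //; exact/measurable_EFinP.
rewrite integral_cst// ge0_integralZl//; last first.
  by move=> w _; rewrite lee_fin sqr_ge0.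
rewrite /= probability_setT mule1.
apply: (@le_trans _ _ ((c / 2)%:E + (2 * c)^-1%:E * (c ^+ 2)%:E)%E).
  by rewrite leeD2l// lee_wpmul2l.
rewrite -EFinM -EFinD lee_fin le_eqVlt; apply/orP; left; apply/eqP.
by field; rewrite gt_eqF.
Qed.

(** The sum of the absolute increments has expectation at most [1], so it is
    almost surely finite, and the telescoping series converges absolutely. *)
Lemma ae_cvg_fast_subsequence X :
  (forall n, measurable_fun setT (X n)) ->
  (forall n, (\int[P]_w ((X n.+1 w - X n w) ^+ 2)%:E <=
              (((2 ^ n.+1)%:R^-1) ^+ 2)%:E)%E) ->
  {ae P, forall w, cvgn (X ^~ w)}.
Proof.
move=> mX hX.
pose D n w := `|X n.+1 w - X n w|.
have mD n : measurable_fun setT (fun w => (D n w)%:E).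
  by apply/measurable_EFinP/measurableT_comp => //; exact: measurable_funB.
have D0 n w : (0 <= (D n w)%:E)%E by rewrite lee_fin /D; exact: normr_ge0.
have intD : (\int[P]_w (\sum_(n <oo) (D n w)%:E) < +oo)%E.
  rewrite integral_nneseries//.
  apply: (@le_lt_trans _ _ (\sum_(n <oo) (1 / (2 ^ (n + 1))%:R)%:E)%E).
    apply: lee_nneseries => n _; first by move=> _; exact: integral_ge0.
    rewrite addn1 div1r; apply: integral_norm_le => //.
    exact: measurable_funB.
  have := @cvg_geometric_eseries_half R 1 0.
  by rewrite /eseries/= => /cvg_lim ->//; rewrite ltry.
have : P.-integrable setT (fun w => \sum_(n <oo) (D n w)%:E)%E.
  apply/integrableP; split; first exact: ge0_emeasurable_sum.
  by under eq_integral do rewrite gee0_abs ?nneseries_ge0//.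
move=> /(integrable_ae measurableT).
apply: filterS => w /(_ I) fin.
suff : cvgn (series (telescope (X ^~ w))).
  rewrite telescopeK => /= h.
  have -> : X ^~ w = (fun n => (X n w - X 0%N w) + X 0%N w).
    by apply/funext => n; rewrite subrK.
  by apply: is_cvgD => //; exact: is_cvg_cst.
apply: normed_cvg; apply: nondecreasing_is_cvgn.
  by apply: nondecreasing_series => n _ _ /=.
exists (fine (\sum_(n <oo) (D n w)%:E)%E) => _ [n _ <-].
rewrite -lee_fin fineK// /series/= -sumEFin.
exact: nneseries_lim_ge.
Qed.

Lemma limn_einf_le (u : (\bar R)^nat) (c : \bar R) :
  (\forall n \near \oo, u n <= c)%E -> (limn_einf u <= c)%E.
Proof.
move=> [N _ uc]; rewrite limn_einf_lim; apply: lime_le; first exact: is_cvg_einfs.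
apply: nearW => n; apply: (@le_trans _ _ (u (maxn n N))).
  by apply: ereal_inf_lbound; exists (maxn n N) => //=; exact: leq_maxl.
exact/uc/leq_maxr.
Qed.

(** The Riesz-Fischer argument: a subsequence with geometrically small increments
    converges almost surely, and Fatou's lemma carries the Cauchy bound [r n]
    over to its limit, which gives the rate for the whole sequence. *)
Lemma mean_square_complete X (r : nat -> R) :
  (forall n, measurable_fun setT (X n)) ->
  r @ \oo --> 0 ->
  (forall m n, (m <= n)%N -> (\int[P]_w ((X n w - X m w) ^+ 2)%:E <= (r m)%:E)%E) ->
  exists Y : {RV P >-> R},
    forall n, (\int[P]_w ((Y w - X n w) ^+ 2)%:E <= (r n)%:E)%E.
Proof.
move=> mX r0 hX.
have /choice[n0 hn0] : forall j, exists n, forall m, (n <= m)%N ->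
    r m <= ((2 ^ j.+1)%:R^-1) ^+ 2.
  move=> j; have e0 : 0 < ((2 ^ j.+1)%:R^-1) ^+ 2 :> R.
    by rewrite exprn_gt0// invr_gt0 ltr0n expn_gt0.
  have /cvgrPdist_le/(_ _ e0)[n _ hn] := r0; exists n => m nm.
  by have := hn _ nm; rewrite sub0r normrN; apply: le_trans; exact: ler_norm.
(* The running maximum makes [phi] monotone; the summand [j] makes it unbounded. *)
pose phi j := (j + \max_(i < j.+1) n0 i)%N.
have phi_ge j : (j <= phi j)%N by exact: leq_addr.
have phi_n0 j : (n0 j <= phi j)%N.
  by rewrite (leq_trans _ (leq_addl _ _))// (leq_bigmax (Ordinal (ltnSn j))).
have phiS j : (phi j <= phi j.+1)%N.
  by rewrite leq_add// [leqRHS]big_ord_recr/= leq_maxl.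
have [N [mN PN cvgX]] : {ae P, forall w, cvgn (fun j => X (phi j) w)}.
  apply: ae_cvg_fast_subsequence => // j.
  by rewrite (le_trans (hX _ _ (phiS j)))// lee_fin; exact: hn0.
pose Y0 w := fine (limn_esup (fun j => (X (phi j) w)%:E)).
have mY : measurable_fun setT Y0.
  apply: (measurableT_comp (@fine_measurable R setT _)) => //.
  by apply: measurable_fun_limn_esup => j; exact/measurable_EFinP.
have Y0E w : cvgn (fun j => X (phi j) w) -> X (phi j) w @[j --> \oo] --> Y0 w.
  move=> c; rewrite /Y0.
  have /cvg_limn_einf_sup[_ ->] : (X (phi j) w)%:E @[j --> \oo] -->
      (limn (fun j => X (phi j) w))%:E.
    by apply: cvg_EFin => //; exact: nearW.
  exact: c.
pose Y : {RV P >-> R} := mfun_Sub (mem_set mY).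
exists Y => n.
apply: (@le_trans _ _
    (\int[P]_w limn_einf (fun j => ((X (phi j) w - X n w) ^+ 2)%:E))%E).
  apply: ae_ge0_le_integral => //.
  - by move=> w _; rewrite lee_fin sqr_ge0.
  - exact: measurable_sqr_dist.
  - move=> w _; rewrite limn_einf_lim.
    apply: lime_ge; first exact: is_cvg_einfs.
    apply: nearW => m; apply: le_ereal_inf_tmp => _ [j _ <-].
    by rewrite lee_fin sqr_ge0.
  - under eq_fun do rewrite -[limn_einf _]oppeK -limn_esupN.
    apply: measurableT_comp => //; apply: measurable_fun_limn_esup => j.
    apply: measurableT_comp => //.
    exact: measurable_sqr_dist.
  - exists N; split => // w /= h; apply: cvgX => /= c; apply: h => _.
    suff /cvg_limn_einf_sup[-> _] : ((X (phi j) w - X n w) ^+ 2)%:E @[j --> \oo]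
        --> ((Y0 w - X n w) ^+ 2)%:E by [].
    apply: cvg_EFin; first exact: nearW.
    under eq_fun do rewrite expr2.
    by rewrite expr2; apply: cvgM; (apply: cvgB; [exact: Y0E|exact: cvg_cst]).
apply: le_trans (fatou _ _ _ _) _ => //.
- by move=> j; exact: measurable_sqr_dist.
- by move=> j w _; rewrite lee_fin sqr_ge0.
apply: limn_einf_le; exists n => // j /= nj.
by apply: hX; exact: leq_trans nj _.
Qed.

End mean_square_completeness.

Section mean_square_dist.
Context d (Om : measurableType d) (R : realType) (P : probability Om R).
Implicit Types X Y U : Om -> R.

Lemma mean_square_distE X Y :
  (mean_square_dist P X Y = \int[P]_w ((X w - Y w) ^+ 2)%:E)%E.
Proof. by rewrite /mean_square_dist unlock. Qed.

Lemma mean_square_dist_ge0 X Y : (0 <= mean_square_dist P X Y)%E.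
Proof. by apply: expectation_ge0 => w; exact: sqr_ge0. Qed.

(** A mean-square limit is only determined almost surely, so a bound on the
    remainder is needed for every such [Y]: compare [Y - X n] with [Y - X m] and
    [X m - X n], then let [m] tend to infinity. *)
Lemma mean_square_cvg_remainder (X : nat -> Om -> R) Y n (r : R) :
  (forall m, measurable_fun setT (X m)) -> measurable_fun setT Y ->
  mean_square_cvg P X Y ->
  (forall m, (n <= m)%N -> (mean_square_dist P (X m) (X n) <= r%:E)%E) ->
  (mean_square_dist P Y (X n) <= (2 * r)%:E)%E.
Proof.
move=> mX mY XY hr.
have cvg2 : (2%:E * mean_square_dist P Y (X m) + 2%:E * r%:E)%E @[m --> \oo]
    --> (2%:E * r%:E)%E.
  rewrite -[X in _ --> X]add0e -[X in (X + _)%E](mule0 2%:E).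
  apply: cvgeD; [by rewrite mule0 -EFinM| |exact: cvg_cst].
  by apply: cvgeZl => //; exact: XY.
rewrite EFinM -(cvg_lim _ cvg2)//.
apply: lime_ge; first by apply/cvg_ex; eexists; exact: cvg2.
exists n => // m /= nm.
apply: le_trans (_ : _ <= 2%:E * mean_square_dist P Y (X m)
  + 2%:E * mean_square_dist P (X m) (X n))%E _.
  rewrite !mean_square_distE.
  apply: integral_sqr_le; [exact: measurable_funB..|].
  by move=> w; rewrite addrA subrK.
by rewrite leeD2l// lee_wpmul2l// hr.
Qed.

End mean_square_dist.

(** * The remainder of the series *)

Section remainder.
Context d (Om : measurableType d) (R : realType) (P : probability Om R).
Variables (H T K : R) (Z : int -> {RV P >-> R}).
Hypothesis H_gt0 : 0 < H.
Hypothesis K_gt0 : 0 < K.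
Hypothesis c_leK : forall k : nat, (0 < k)%N ->
  `|c_ H T k| <= K * k%:R `^ (- (2 * H + 1)).
Hypothesis gaussZ : forall k, standard_gaussian (Z k).
Hypothesis indepZ : independent_RVs Z.

Lemma measurable_partial_sum N t : measurable_fun setT (partial_sum H T Z N t).
Proof.
apply: measurable_funD; first exact: measurable_funM.
apply: measurable_sum => k.
apply: measurable_funM => //; apply: measurable_funD; exact: measurable_funM.
Qed.

Lemma gauss_sqr_ge0 : 0 <= gauss_sqr R.
Proof. by rewrite fine_ge0// integral_ge0// => x _; rewrite lee_fin sqr_ge0. Qed.

(** Stated for an injective relabelling [sgn] so as to cover both the family
    [(Z_k)] and the family [(Z_(- k))], with [k >= 1]. *)
Lemma integral_sqr_gaussian_sum (sgn : nat -> int) (r : seq nat) (a : nat -> R) :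
  injective sgn -> uniq r ->
  (\int[P]_w ((\sum_(k <- r) a k * Z (sgn k) w) ^+ 2)%:E =
   (gauss_sqr R * \sum_(k <- r) a k ^+ 2)%:E)%E.
Proof.
move=> sgn_inj ur.
apply: (@integral_sqr_orthogonal_sum _ _ _ P _ r (fun k => Z (sgn k))) => //.
- by move=> k; exact: integral_sqr_gaussian.
- move=> i j ij; apply: gaussian_uncorrelated => // A B mA mB.
  by apply: independent_RVs_pair => //; rewrite (inj_eq sgn_inj).
Qed.

Definition remainder_bound : R := 5 * gauss_sqr R * (K / (2 * H)).

(** The sine part and the cosine part are each orthogonal sums. Their trigonometric
    factors have squares at most [1] and [4], and the squared coefficients are
    at most [K / 2 * k^(- 2 H - 1)]. *)
Lemma partial_sum_remainder (N M : nat) t : (0 < N)%N -> (N <= M)%N ->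
  (\int[P]_w ((partial_sum H T Z M t w - partial_sum H T Z N t w) ^+ 2)%:E <=
   (remainder_bound * N%:R `^ (- (2 * H)))%:E)%E.
Proof.
move=> N0 NM.
pose s k := Num.sqrt (- c_ H T k / 2).
pose a k := s k * sin (k%:R * pi * t / T).
pose b k := s k * (1 - cos (k%:R * pi * t / T)).
pose r := index_iota N.+1 M.+1.
have ur : uniq r by exact: iota_uniq.
have sqs k : (0 < k)%N -> s k ^+ 2 <= K / 2 * k%:R `^ (- (2 * H + 1)).
  move=> k0; apply: (@le_trans _ _ (`|c_ H T k| / 2)).
    (* If [c_ H T k] is positive, the square root is [0]. *)
    have [c0|c0] := leP 0 (- c_ H T k / 2).
      rewrite sqr_sqrtr// ler_pM2r ?invr_gt0//.
      by rewrite -normrN ler_norm.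
    by rewrite /s ltr0_sqrtr// expr0n/= divr_ge0.
  rewrite mulrAC ler_pM2r ?invr_gt0//; exact: c_leK.
have suma (f : nat -> R) (q : R) : 0 <= q ->
    (forall k, f k ^+ 2 <= q) ->
    \sum_(k <- r) (s k * f k) ^+ 2 <= q * (K / 2 * (N%:R `^ (- (2 * H)) / (2 * H))).
  move=> q0 fq.
  have H20 : 0 < 2 * H by rewrite mulr_gt0.
  apply: (@le_trans _ _ (q * (K / 2 * \sum_(k <- r) k%:R `^ (- (2 * H + 1))))).
    rewrite !mulr_sumr /r big_nat_cond [leRHS]big_nat_cond.
    apply: ler_sum => k /andP[/andP[Nk _] _].
    rewrite exprMn mulrC ler_pM ?sqr_ge0 ?fq// sqs//.
    exact: leq_trans Nk.
  rewrite ler_wpM2l// ler_wpM2l ?divr_ge0 ?(ltW K_gt0)//.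
  exact: sum_powR_tail.
apply: le_trans (@integral_sqr_le _ _ _ P _
  (fun w => \sum_(k <- r) a k * Z k%:Z w)
  (fun w => \sum_(k <- r) b k * Z (- k%:Z) w) _ _ _ _) _.
- by apply: measurable_funB; exact: measurable_partial_sum.
- by apply: measurable_sum => k; exact: measurable_funM.
- by apply: measurable_sum => k; exact: measurable_funM.
- move=> w; rewrite /partial_sum (@big_cat_nat _ _ _ N.+1 1 M.+1)//=.
  rewrite addrA [LHS]addrAC subrr add0r -big_split/=; apply: eq_bigr => k _.
  by rewrite /a /b /s; ring.
rewrite (@integral_sqr_gaussian_sum (fun k => k%:Z))//; last by move=> i j [].
rewrite (@integral_sqr_gaussian_sum (fun k => - k%:Z))//; last first.
  by move=> i j /oppr_inj[].
rewrite -!EFinM -EFinD lee_fin -mulrDr -mulrDr.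
have := suma (fun k => sin (k%:R * pi * t / T)) 1 ler01.
have := suma (fun k => 1 - cos (k%:R * pi * t / T)) 4 (ler0n _ _).
set Sb := \sum_(k <- r) _; set Sa := \sum_(k <- r) _ => hb ha.
have {}hb : Sb <= 4 * (K / 2 * (N%:R `^ (- (2 * H)) / (2 * H))).
  apply: hb => k; have := cos_geN1 (k%:R * pi * t / T).
  have := cos_le1 (k%:R * pi * t / T); nra.
have {}ha : Sa <= 1 * (K / 2 * (N%:R `^ (- (2 * H)) / (2 * H))).
  apply: ha => k; have := sin_geN1 (k%:R * pi * t / T).
  have := sin_le1 (k%:R * pi * t / T); nra.
rewrite mulrCA /remainder_bound.
have -> : 5 * gauss_sqr R * (K / (2 * H)) * N%:R `^ (- (2 * H)) =
   gauss_sqr R * (2 * (5 * (K / 2 * (N%:R `^ (- (2 * H)) / (2 * H))))).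
  by field; rewrite gt_eqF.
rewrite ler_wpM2l ?gauss_sqr_ge0// ler_pM2l//; lra.
Qed.

End remainder.

Theorem proposition3p5 (R : realType) (T H : R)
    (T_gt0 : 0 < T) (H_gt0 : 0 < H) (H_lt1 : H < 1) (H_neq : H <> 1 / 2) :
  exists C : R, 0 < C /\
    forall (d : measure_display) (Om : measurableType d)
      (P : probability Om R) (Z : int -> {RV P >-> R}),
      (forall k : int, standard_gaussian (Z k)) ->
      independent_RVs Z ->
      (forall t : R, 0 <= t <= T ->
         exists Bt : {RV P >-> R},
           mean_square_cvg P (fun N => partial_sum H T Z N t) Bt) /\
      (forall B : R -> {RV P >-> R},
         (forall t : R, 0 <= t <= T ->
            mean_square_cvg P (fun N => partial_sum H T Z N t) (B t)) ->
         forall N : nat, (1 <= N)%N ->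
           (ereal_sup [set sqrte (mean_square_dist P (B t) (partial_sum H T Z N t))
                      | t in [set t : R | 0 <= t <= T]%R]
            <= (C * N%:R `^ (- H))%:E)%E).
Proof.
have Hb : 0 < H < 1 by rewrite H_gt0.
have [K K0 hK] := c_le T_gt0 Hb (introN eqP H_neq).
have H2 : 0 < 2 * H by rewrite mulr_gt0.
pose A := remainder_bound H K.
have A0 : 0 <= A.
  apply: mulr_ge0; last by rewrite divr_ge0 ?ltW.
  by apply: mulr_ge0 => //; exact: gauss_sqr_ge0.
(* The summand [1] makes the constant positive. *)
exists (Num.sqrt (2 * A) + 1); split; first by rewrite ltr_wpDl ?sqrtr_ge0.
move=> d Om P Z gZ iZ.
have hS (t : R) (N M : nat) :=
  @partial_sum_remainder _ _ _ P H T K Z H_gt0 K0 hK gZ iZ N M t.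
have mS (t : R) (N : nat) := @measurable_partial_sum _ _ _ P H T Z N t.
split=> [t tT|B cvgB N N1].
  (* Shifted by one, because [0 `^ (- (2 * H))] is [0]. *)
  pose r n : R := A * n.+1%:R `^ (- (2 * H)).
  have r0 : r @ \oo --> 0.
    rewrite -[X in _ --> X](mulr0 A); apply: cvgM; first exact: cvg_cst.
    exact: cvg_natS_powRN.
  have [Bt hBt] := @mean_square_complete _ _ _ P _ r (fun n => mS t n.+1) r0
    (fun m n mn => hS t m.+1 n.+1 (ltn0Sn m) mn).
  have {}r0 : (r n)%:E @[n --> \oo] --> 0%E.
    by apply: cvg_EFin => //; exact: nearW.
  exists Bt; rewrite /mean_square_cvg -cvg_shiftS /=.
  apply: (squeeze_cvge _ (cvg_cst 0%E) r0).
  apply: nearW => n; rewrite mean_square_dist_ge0/=.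
  by rewrite mean_square_distE.
apply: ge_ereal_sup => _ [t /= tT <-].
have AN : 0 <= 2 * (A * N%:R `^ (- (2 * H))).
  by rewrite mulr_ge0// mulr_ge0// powR_ge0.
have h : (mean_square_dist P (B t) (partial_sum H T Z N t)
    <= (2 * (A * N%:R `^ (- (2 * H))))%:E)%E.
  apply: (@mean_square_cvg_remainder _ _ _ P (fun N => partial_sum H T Z N t)) => //.
  - exact: cvgB.
  - by move=> M NM; rewrite mean_square_distE; exact: hS.
apply: (@le_trans _ _ (sqrte (2 * (A * N%:R `^ (- (2 * H))))%:E)).
  by rewrite lee_sqrt.
have A2 : 0 <= 2 * A by apply: mulr_ge0.
rewrite /= lee_fin mulrA (sqrtrM _ A2).
have -> : - (2 * H) = - H * 2%:R by ring.
rewrite powRrM powR_mulrn ?powR_ge0// sqrtr_sqr ger0_norm ?powR_ge0//.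
by rewrite ler_wpM2r ?powR_ge0// lerDl.
Qed.
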